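(* (a) There exists an $\infty$-ample simplicial complex with a countable set of vertexes. (b) Any two $\infty$-ample simplicial complexes with countable sets of vertexes are isomorphic.
   Context: For $U\subseteq V(X)$, $X_U$ denotes the induced subcomplex on $U$; $\mathrm{Lk}_X(v)$ is the subcomplex of simplexes $\sigma$ with $v\notin\sigma$ and $\sigma\cup\{v\}\in X$. For an integer $r\ge1$, a nonempty simplicial complex $X$ is $r$-ample if for every finite $U\subseteq V(X)$ with $|U|\le r$ and every subcomplex $A\subseteq X_U$ (possibly empty) there exists $v\in V(X)\setminus U$ with $\mathrm{Lk}_X(v)\cap X_U=A$. $X$ is $\infty$-ample if it is $r$-ample for every $r\ge1$. *)

(* Defs.v *)
From mathcomp Require Import all_boot finmap.
From mathcomp Require Import boolp classical_sets functions cardinality.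

Set Implicit Arguments.
Unset Strict Implicit.
Unset Printing Implicit Defensive.

Local Open Scope classical_set_scope.

(* [T] is only an ambient type of labels: the vertex set of a complex is the
   subset [vertices X] of [T].  In this way subcomplexes, links and induced
   subcomplexes are again complexes over [T]; simplexes are nonempty, and the
   complex with no simplexes is allowed. *)
Record simplicial_complex (T : choiceType) := SimplicialComplex {
  simplexes : set {fset T};
  simplex_neq0 : forall s, simplexes s -> s != fset0;
  simplex_face : forall s t, simplexes s ->
    (t `<=` s)%fset -> t != fset0 -> simplexes t }.

Section Complexes.
Variable T : choiceType.
Implicit Types (X A : simplicial_complex T) (U s t : {fset T}) (v : T).

Definition vertices X : set T := [set v | simplexes X [fset v]%fset].

Definition subcomplex A X : Prop := simplexes A `<=` simplexes X.

Definition induced_simplexes X U : set {fset T} :=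
  [set s | simplexes X s /\ (s `<=` U)%fset].

Lemma induced_neq0 X U s : induced_simplexes X U s -> s != fset0.
Proof. by case=> /simplex_neq0. Qed.

Lemma induced_face X U s t : induced_simplexes X U s ->
  (t `<=` s)%fset -> t != fset0 -> induced_simplexes X U t.
Proof.
move=> [Xs sU] ts t0; split; first exact: simplex_face Xs ts t0.
exact: fsubset_trans ts sU.
Qed.

Definition induced X U : simplicial_complex T :=
  SimplicialComplex (@induced_neq0 X U) (@induced_face X U).

(* [s != fset0] is needed: otherwise the empty set would be a simplex of the
   link of every vertex. *)
Definition link_simplexes X v : set {fset T} :=
  [set s | [/\ s != fset0, v \notin s & simplexes X (v |` s)%fset]].

Lemma link_neq0 X v s : link_simplexes X v s -> s != fset0.
Proof. by case. Qed.

Lemma link_face X v s t : link_simplexes X v s ->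
  (t `<=` s)%fset -> t != fset0 -> link_simplexes X v t.
Proof.
move=> [_ vs Xvs] ts t0; split=> //.
  by apply: contra vs; exact: (fsubsetP ts).
apply: simplex_face Xvs (fsetUS _ ts) _.
by apply/fset0Pn; exists v; rewrite !inE eqxx.
Qed.

Definition link X v : simplicial_complex T :=
  SimplicialComplex (@link_neq0 X v) (@link_face X v).

Definition ample (r : nat) X : Prop :=
  vertices X !=set0 /\
  forall U, [set` U] `<=` vertices X -> #|` U| <= r ->
  forall A, subcomplex A (induced X U) ->
  exists v, [/\ vertices X v, v \notin U &
    simplexes (link X v) `&` simplexes (induced X U) = simplexes A].

Definition infty_ample X : Prop := forall r, 1 <= r -> ample r X.

End Complexes.

(* Only the restriction of [f] to [vertices X] matters; taking it total on [T]
   is harmless as soon as [Y] has a vertex. *)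
Definition isomorphic (T T' : choiceType)
    (X : simplicial_complex T) (Y : simplicial_complex T') : Prop :=
  exists f : T -> T', set_bij (vertices X) (vertices Y) f /\
    forall s : {fset T}, [set` s] `<=` vertices X ->
      (simplexes X s <-> simplexes Y [fset f x | x in s]%fset).

(* Main.v *)
Require Import Defs.
From mathcomp Require Import all_boot finmap.
From mathcomp Require Import boolp classical_sets functions cardinality.

(** Existence: let [F] enumerate the finite families of finite sets of naturals,
    each of them infinitely often, and let [s] be a simplex when every nonempty
    [t] contained in [s] and lying strictly below some [v] in [s] belongs to
    [F v].  A finite complex [A] on [U] is then the link, within [U], of any
    [v] above [U] with [F v = A].

    Uniqueness: back and forth.  A finite partial isomorphism [P] extends to a
    new vertex [x] by transporting the link of [x] along [P] and realizing it
    as a link on the other side, and a chain of such extensions exhausts both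
    vertex sets. *)

Set Implicit Arguments.
Unset Strict Implicit.
Unset Printing Implicit Defensive.

Local Open Scope classical_set_scope.
Local Open Scope fset_scope.

Lemma countable_setU (T : Type) (A B : set T) :
  countable A -> countable B -> countable (A `|` B)%classic.
Proof.
by move=> cA cB; rewrite -bigcup2E; apply: bigcup_countable => // -[|[|n]] _.
Qed.

Section FiniteImages.
Variables (T T' : choiceType) (f : T -> T').
Implicit Types s t : {fset T}.

Lemma imfset_eq0 s : (f @` s == fset0) = (s == fset0).
Proof.
apply/eqP/eqP => [fs0|->]; last exact: imfset0.
apply/fsetP => x; apply/negbTE/negP => xs.
by have := in_imfset imfset_key f xs; rewrite fs0.
Qed.

Lemma imfsetS s t : s `<=` t -> f @` s `<=` f @` t.
Proof. by move=> /fsubsetP st; apply: subset_imfset => x /st. Qed.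

Lemma imfset_preimage s (t : {fset T'}) : t `<=` f @` s ->
  f @` [fset x in s | f x \in t] = t.
Proof.
move=> /fsubsetP ts; apply/fsetP => y; apply/imfsetP/idP => [[x /= + ->]|yt].
  by rewrite !inE => /andP[].
have /imfsetP[x /= xs yE] := ts y yt.
by exists x => //; rewrite !inE xs -yE.
Qed.

End FiniteImages.

Section Links.
Variables (T : choiceType) (X : simplicial_complex T).
Implicit Types (A : simplicial_complex T) (U s : {fset T}) (v : T).

Lemma link_subcomplex v : subcomplex (link X v) X.
Proof. by move=> s [s0 _ Xvs]; exact: simplex_face Xvs (fsubsetU1 v s) s0. Qed.

Lemma simplexes_fsetU1 v s : vertices X v -> v \notin s ->
  simplexes X (v |` s) <-> s == fset0 \/ simplexes (link X v) s.
Proof.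
move=> Xv vs; split=> [Xvs|[/eqP->|[]//]]; last by rewrite fsetU0.
by have [?|s0] := boolP (s == fset0); [left|right].
Qed.

Lemma infty_ampleP : infty_ample X <-> vertices X !=set0 /\
  forall U A, ([set` U] `<=` vertices X)%classic ->
    subcomplex A (induced X U) ->
  exists v, [/\ vertices X v, v \notin U &
    forall s, s `<=` U -> simplexes (link X v) s <-> simplexes A s].
Proof.
split=> [ampX|[X0 ampX] r _]; split=> //; first exact: (ampX 1 isT).1.
  move=> U A UX AU.
  have [v [Xv vU lkA]] := (ampX #|` U|.+1 isT).2 U UX (leqnSn _) A AU.
  exists v; split=> // s sU; rewrite -lkA; split=> [lks|[]//]; split=> //.
  by split=> //; exact: link_subcomplex lks.
move=> U UX _ A AU; have [v [Xv vU lkA]] := ampX U A UX AU.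
exists v; split=> //; apply/seteqP; split=> s /=.
  by move=> [lks [_ sU]]; exact/(lkA s sU).
by move=> As; have [Xs sU] := AU s As; split=> //; exact/(lkA s sU).
Qed.

End Links.

Lemma finite_subcomplex_induced (T : choiceType)
    (A X : simplicial_complex T) (U : {fset T}) :
  subcomplex A (induced X U) -> finite_set (simplexes A).
Proof.
move=> AU; apply: sub_finite_set (finite_fset (fpowerset U)) => s /AU[_ sU].
by rewrite /= fpowersetE.
Qed.

Lemma recurrent_enumeration (T : countType) (x0 : T) :
  exists F : nat -> T, forall N x, exists2 v, N < v & F v = x.
Proof.
exists (fun v => odflt x0 (choice.unpickle (logn 2 v))) => N x.
exists (2 ^ choice.pickle x * (2 * N).+1).
  by apply: leq_trans (leq_pmull _ _); rewrite ?expn_gt0// ltnS leq_pmull.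
rewrite lognM ?expn_gt0// pfactorK// logn_coprime ?addn0 ?choice.pickleK//.
by rewrite coprime2n /= oddM.
Qed.

Section GenericComplex.
Variable F : nat -> {fset {fset nat}}.
Implicit Types s t U : {fset nat}.

Definition generic_simplexes : set {fset nat} := [set s | s != fset0 /\
  forall v t, v \in s -> t `<=` s -> t != fset0 ->
    {in t, forall x, x < v} -> t \in F v].

Lemma generic_neq0 s : generic_simplexes s -> s != fset0.
Proof. by case. Qed.

Lemma generic_face s t : generic_simplexes s -> t `<=` s -> t != fset0 ->
  generic_simplexes t.
Proof.
move=> [_ sF] ts t0; split=> // v u vt ut.
by apply: sF; [exact: (fsubsetP ts)|exact: fsubset_trans ts].
Qed.

Definition generic_complex : simplicial_complex nat :=
  SimplicialComplex generic_neq0 generic_face.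

Lemma vertices_generic v : vertices generic_complex v.
Proof.
split=> [|w t]; first by apply/fset0Pn; exists v; rewrite inE.
rewrite inE => /eqP-> tv /fset0Pn[x xt] /(_ x xt).
by have := fsubsetP tv x xt; rewrite inE => /eqP->; rewrite ltnn.
Qed.

Lemma generic_fsetU1 v s : {in s, forall x, x < v} -> generic_simplexes s ->
  (forall t, t `<=` s -> t != fset0 -> t \in F v) ->
  generic_simplexes (v |` s).
Proof.
move=> ltv [_ sF] vF; split; first by apply/fset0Pn; exists v; exact: fset1U1.
move=> w t wvs tvs t0 ltw.
have le_wv : w <= v by move: wvs; rewrite !inE => /orP[/eqP->//|/ltv/ltnW].
have ts : t `<=` s.
  apply/fsubsetP => x xt; have := fsubsetP tvs x xt.
  rewrite !inE => /orP[/eqP xv|//].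
  by have := ltw x xt; rewrite xv ltnNge le_wv.
by move: wvs; rewrite !inE => /orP[/eqP->|ws]; [exact: vF|exact: sF].
Qed.

Lemma link_generic v s : {in s, forall x, x < v} ->
  simplexes (link generic_complex v) s <->
  generic_simplexes s /\ forall t, t `<=` s -> t != fset0 -> t \in F v.
Proof.
move=> ltv; split=> [lks|[Xs vF]].
  split=> [|t ts t0]; first exact: link_subcomplex lks.
  have [_ _ [_ vsF]] := lks; apply: vsF => //; first exact: fset1U1.
    exact: fsubset_trans ts (fsubsetU1 v s).
  by move=> x /(fsubsetP ts)/ltv.
split; last exact: generic_fsetU1.
  exact: generic_neq0 Xs.
by apply/negP => /ltv; rewrite ltnn.
Qed.

Lemma infty_ample_generic :
  (forall N A, exists2 v, N < v & F v = A) -> infty_ample generic_complex.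
Proof.
move=> recF; apply/infty_ampleP; split.
  by exists 0; exact: vertices_generic.
move=> U A _ AU; have finA := finite_subcomplex_induced AU.
have [v ltv FvA] := recF (\max_(x <- U) x) (fset_set (simplexes A)).
have inFv t : t \in F v <-> simplexes A t.
  by rewrite FvA in_fset_set// inE.
have Uv : {in U, forall x, x < v}.
  by move=> x xU; apply: leq_ltn_trans ltv; exact: leq_bigmax_seq.
exists v; split=> [||s sU]; first exact: vertices_generic.
  by apply/negP => /Uv; rewrite ltnn.
have /link_generic -> : {in s, forall x, x < v} by move=> x /(fsubsetP sU)/Uv.
split=> [[Xs sA]|As]; first by apply/inFv/sA => //; exact: generic_neq0 Xs.
split=> [|t ts t0]; first by have [] := AU s As.
by apply/inFv; exact: simplex_face As ts t0.
Qed.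

End GenericComplex.

Lemma exists_infty_ample : exists X : simplicial_complex nat, infty_ample X.
Proof.
have [F recF] := recurrent_enumeration (fset0 : {fset {fset nat}}).
by exists (generic_complex F); exact: infty_ample_generic.
Qed.

Lemma rasiowa_sikorski (Q : Type) (le : Q -> Q -> Prop) (I : set Q)
    (D : set (set Q)) (q0 : Q) :
  (forall q, le q q) -> (forall r q p, le q r -> le r p -> le q p) ->
  countable D ->
  (forall d q, D d -> I q -> exists r, [/\ I r, le q r & d r]) -> I q0 ->
  exists p : nat -> Q, [/\ forall n, I (p n),
    {homo p : m n / m <= n >-> le m n} & forall d, D d -> exists n, d (p n)].
Proof.
move=> le_refl le_trans /countable_injP[c cinj] denseD Iq0.
have /choice[ext extP] (nq : nat * Q) : exists r, I nq.2 ->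
    [/\ I r, le nq.2 r & forall d, D d -> c d = nq.1 -> d r].
  case: nq => n q /=; have [Iq|] := pselect (I q); last by exists q.
  have [[d [Dd cd]]|noD] := pselect (exists d, D d /\ c d = n); last first.
    by exists q => _; split=> // d Dd cd; case: noD; exists d.
  have [r [Ir qr dr]] := denseD d q Dd Iq.
  by exists r => _; split=> // d' Dd' cd'; rewrite (cinj d' d) ?inE ?cd.
pose p := nat_rect (fun=> Q) q0 (fun n q => ext (n, q)).
have Ip n : I (p n) by elim: n => [//|n /(extP (n, p n))[]].
exists p; split=> // [|d Dd].
  by apply: homo_leq => // n; have [] := extP (n, p n) (Ip n).
by exists (c d).+1; have [_ _] := extP (c d, p (c d)) (Ip _); apply.
Qed.

Lemma fsubset_chain (K : choiceType) (p : nat -> {fset K}) (s : {fset K}) :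
  {homo p : m n / m <= n >-> m `<=` n} ->
  {in s, forall x, exists n, x \in p n} -> exists n, s `<=` p n.
Proof.
move=> p_mono sp.
have /choice[c cP] (x : K) : exists n, x \in s -> x \in p n.
  by have [/sp[n]|] := boolP (x \in s); [exists n|exists 0].
exists (\max_(x <- s) c x); apply/fsubsetP => x xs.
by apply: (fsubsetP (p_mono _ _ _)) (cP x xs); exact: leq_bigmax_seq.
Qed.

Lemma relation_set_bij (K T T' : Type) (f : K -> T) (g : K -> T')
    (G : set K) :
  G !=set0 -> (forall k l, G k -> G l -> f k = f l <-> g k = g l) ->
  exists2 h : T -> T', set_bij (f @` G)%classic (g @` G)%classic h &
    forall k, G k -> h (f k) = g k.
Proof.
move=> [k0 Gk0] Ginj.
have /choice[h hP] (x : T) : exists y, forall k, G k -> f k = x -> g k = y.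
  have [[k [Gk fk]]|noG] := pselect (exists k, G k /\ f k = x).
    by exists (g k) => l Gl fl; apply/(Ginj l k) => //; rewrite fl.
  by exists (g k0) => k Gk fk; case: noG; exists k.
have hE k : G k -> h (f k) = g k by move=> Gk; rewrite (hP (f k) k).
exists h => //; split.
- by move=> _ [k Gk <-]; rewrite hE//; exists k.
- move=> _ _ /set_mem[k Gk <-] /set_mem[l Gl <-].
  by rewrite !hE// => /(Ginj k l Gk Gl).
- by move=> _ [k Gk <-]; exists (f k); [exists k|exact: hE].
Qed.

(** A finite relation between [T] and [T'] is encoded by a finite set [P] of
    elements of [K], where [k] relates [f k] to [g k]: exchanging [f] and [g]
    then reverses the relation without changing [P]. *)
Section BackAndForth.
Variables (K T T' : choiceType) (f : K -> T) (g : K -> T').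
Implicit Types P Q : {fset K}.

Definition partial_bij (A : set T) (B : set T') P : Prop :=
  {in P, forall k, A (f k) /\ B (g k)} /\
  {in P &, forall k l, f k = f l <-> g k = g l}.

Lemma partial_bij0 A B : partial_bij A B fset0.
Proof. by []. Qed.

Lemma partial_bij_fsetU1 A B P k : partial_bij A B P -> A (f k) -> B (g k) ->
  f k \notin f @` P -> g k \notin g @` P -> partial_bij A B (k |` P).
Proof.
move=> [PAB Pinj] Ak Bk fkP gkP; split=> [l|].
  by rewrite !inE => /orP[/eqP->|/PAB].
have fkN l : l \in P -> f l <> f k.
  by move=> lP flk; move: fkP; rewrite -flk in_imfset.
have gkN l : l \in P -> g l <> g k.
  by move=> lP glk; move: gkP; rewrite -glk in_imfset.
move=> l m; rewrite !inE => /orP[/eqP->|lP] /orP[/eqP->|mP] //.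
- by split=> /esym; [move/(fkN m mP)|move/(gkN m mP)].
- by split=> [/(fkN l lP)|/(gkN l lP)].
- exact: Pinj.
Qed.

Lemma partial_bij_imfsetS A B P Q Q' : partial_bij A B P ->
  Q `<=` P -> Q' `<=` P -> g @` Q `<=` g @` Q' -> f @` Q `<=` f @` Q'.
Proof.
move=> [_ Pinj] /fsubsetP QP /fsubsetP Q'P /fsubsetP gQQ'.
apply/fsubsetP => _ /imfsetP[k /= kQ ->].
have /imfsetP[l /= lQ' gkl] := gQQ' _ (in_imfset _ g kQ).
by rewrite ((Pinj k l (QP k kQ) (Q'P l lQ')).2 gkl) in_imfset.
Qed.

Lemma set_bij_chain (A : set T) (B : set T') (p : nat -> {fset K}) :
  A !=set0 -> {homo p : m n / m <= n >-> m `<=` n} ->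
  (forall n, partial_bij A B (p n)) ->
  (forall x, A x -> exists n, x \in f @` p n) ->
  (forall y, B y -> exists n, y \in g @` p n) ->
  exists2 h : T -> T', set_bij A B h &
    forall n, {in p n, forall k, h (f k) = g k}.
Proof.
move=> [x0 Ax0] p_mono pbij fA gB.
pose G : set K := [set k | exists n, k \in p n].
have G0 : G !=set0.
  by have [n /imfsetP[k /= kp _]] := fA x0 Ax0; exists k; exists n.
have Ginj k l : G k -> G l -> f k = f l <-> g k = g l.
  move=> Gk Gl.
  have [m|n /fsubsetP klp] := fsubset_chain p_mono (s := [fset k; l]).
    by rewrite !inE => /orP[]/eqP->.
  by have [_] := pbij n; apply; apply: klp; rewrite !inE eqxx ?orbT.
have imageG (L : choiceType) (a : K -> L) (C : set L) :
    (forall n, {in p n, forall k, C (a k)}) ->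
    (forall z, C z -> exists n, z \in a @` p n) -> (a @` G)%classic = C.
  move=> pC aC; apply/seteqP; split=> [_ [k [n kp] <-]|z /aC[n]].
    exact: pC kp.
  by move=> /imfsetP[k /= kp ->]; exists k => //; exists n.
have fG : (f @` G)%classic = A by apply: imageG => // n k /(pbij n).1[].
have gG : (g @` G)%classic = B by apply: imageG => // n k /(pbij n).1[].
have [h hbij hE] := relation_set_bij G0 Ginj; rewrite fG gG in hbij.
by exists h => // n k kp; apply: hE; exists n.
Qed.

Lemma back_and_forth (A : set T) (B : set T') (I : set {fset K}) :
  countable A -> countable B -> A !=set0 ->
  (forall P, I P -> partial_bij A B P) -> I fset0 ->
  (forall P x, I P -> A x -> exists P', [/\ I P', P `<=` P' & x \in f @` P']) ->
  (forall P y, I P -> B y -> exists P', [/\ I P', P `<=` P' & y \in g @` P']) ->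
  exists2 h : T -> T', set_bij A B h &
    forall s : {fset T}, ([set` s] `<=` A)%classic ->
    exists P, [/\ I P, s `<=` f @` P & {in P, forall k, h (f k) = g k}].
Proof.
move=> cA cB A0 Ibij I0 forth back.
pose covers_l x : set {fset K} := [set P | x \in f @` P].
pose covers_r y : set {fset K} := [set P | y \in g @` P].
pose D := ([set covers_l x | x in A] `|` [set covers_r y | y in B])%classic.
have cD : countable D.
  by apply: countable_setU; apply: sub_countable (card_image_le _ _) _.
have denseD d P : D d -> I P -> exists P', [/\ I P', P `<=` P' & d P'].
  by move=> [[x Ax <-]|[y By <-]] IP; [exact: forth|exact: back].
have [p [Ip p_mono pD]] := rasiowa_sikorski (@fsubset_refl K)
  (@fsubset_trans K) cD denseD I0.
have fA x : A x -> exists n, x \in f @` p n.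
  by move=> Ax; apply: (pD (covers_l x)); left; exists x.
have gB y : B y -> exists n, y \in g @` p n.
  by move=> By; apply: (pD (covers_r y)); right; exists y.
have [h hbij hE] := set_bij_chain A0 p_mono (fun n => Ibij _ (Ip n)) fA gB.
exists h => // s sA.
have fp_mono : {homo (fun n => f @` p n) : m n / m <= n >-> m `<=` n}.
  by move=> m n mn; apply/imfsetS/p_mono.
have [|n sp] := fsubset_chain fp_mono (s := s); first by move=> x /sA/fA.
by exists (p n); split=> //; exact: hE.
Qed.

End BackAndForth.

Section ImageComplexes.
Variables (T T' : choiceType) (f : T -> T').

Section Preimage.
Variable A : simplicial_complex T'.

Definition preimage_simplexes : set {fset T} := [set s | simplexes A (f @` s)].

Lemma preimage_simplex_neq0 s : preimage_simplexes s -> s != fset0.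
Proof. by move=> /simplex_neq0; rewrite imfset_eq0. Qed.

Lemma preimage_simplex_face s t : preimage_simplexes s ->
  t `<=` s -> t != fset0 -> preimage_simplexes t.
Proof.
by move=> As ts t0; apply: simplex_face As (imfsetS f ts) _; rewrite imfset_eq0.
Qed.

Definition preimage_complex : simplicial_complex T :=
  SimplicialComplex preimage_simplex_neq0 preimage_simplex_face.

End Preimage.

Section Image.
Variable A : simplicial_complex T.

Definition image_simplexes : set {fset T'} := [set f @` s | s in simplexes A].

Lemma image_simplex_neq0 t : image_simplexes t -> t != fset0.
Proof. by move=> [s /simplex_neq0 s0 <-]; rewrite imfset_eq0. Qed.

Lemma image_simplex_face t u : image_simplexes t ->
  u `<=` t -> u != fset0 -> image_simplexes u.
Proof.
move=> [s As <-] /imfset_preimage uE u0; exists [fset x in s | f x \in u] => //.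
apply: simplex_face As _ _; last by rewrite -(imfset_eq0 f) uE.
by apply/fsubsetP => x; rewrite !inE => /andP[].
Qed.

Definition image_complex : simplicial_complex T' :=
  SimplicialComplex image_simplex_neq0 image_simplex_face.

End Image.

End ImageComplexes.

Section PartialIsomorphisms.
Variables (K T T' : choiceType) (f : K -> T) (g : K -> T').
Variables (X : simplicial_complex T) (Y : simplicial_complex T').
Implicit Types (P Q : {fset K}) (A : simplicial_complex T).

Definition partial_iso P : Prop :=
  partial_bij f g (vertices X) (vertices Y) P /\
  forall Q, Q `<=` P -> simplexes X (f @` Q) <-> simplexes Y (g @` Q).

Lemma partial_iso0 : partial_iso fset0.
Proof.
split=> [|Q]; first exact: partial_bij0.
rewrite fsubset0 => /eqP->; rewrite !imfset0.
by split=> /simplex_neq0; rewrite eqxx.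
Qed.

Lemma partial_iso_fsetU1 P k : partial_iso P ->
  vertices X (f k) -> vertices Y (g k) ->
  f k \notin f @` P -> g k \notin g @` P ->
  (forall Q, Q `<=` P ->
    simplexes (link X (f k)) (f @` Q) <-> simplexes (link Y (g k)) (g @` Q)) ->
  partial_iso (k |` P).
Proof.
move=> [Pbij PXY] Xk Yk fkP gkP lkXY; split; first exact: partial_bij_fsetU1.
move=> Q QkP; have QP : Q `\ k `<=` P by rewrite fsubDset.
have [kQ|kQ] := boolP (k \in Q); last by apply: PXY; rewrite -(mem_fsetD1 kQ).
rewrite -(fsetD1K kQ) !imfsetU1.
have fkQ : f k \notin f @` (Q `\ k).
  by apply: contra fkP; apply/fsubsetP/imfsetS.
have gkQ : g k \notin g @` (Q `\ k).
  by apply: contra gkP; apply/fsubsetP/imfsetS.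
by rewrite !simplexes_fsetU1// !imfset_eq0 lkXY.
Qed.

Lemma partial_iso_simplexes P (h : T -> T') (s : {fset T}) : partial_iso P ->
  s `<=` f @` P -> {in P, forall k, h (f k) = g k} ->
  simplexes X s <-> simplexes Y (h @` s).
Proof.
move=> [_ PXY] /imfset_preimage; set Q := [fset k in P | _] => fQ hE.
have QP : {subset Q <= P} by move=> k; rewrite !inE => /andP[].
have -> : h @` s = g @` Q.
  by rewrite -fQ -imfset_comp; apply: eq_in_imfset => k /QP/hE.
by rewrite -[in X in X <-> _]fQ; apply/PXY/fsubsetP.
Qed.

Definition transport P A : simplicial_complex T' :=
  image_complex g (induced (preimage_complex f A) P).

Lemma transport_subcomplex P A : partial_iso P -> subcomplex A X ->
  subcomplex (transport P A) (induced Y (g @` P)).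
Proof.
move=> [_ PXY] AX _ [Q [/AX XQ QP] <-]; split; first exact/(PXY Q QP).
exact: imfsetS.
Qed.

Lemma transport_imfset P Q A : partial_iso P -> Q `<=` P ->
  simplexes (transport P A) (g @` Q) <-> simplexes A (f @` Q).
Proof.
move=> [Pbij _] QP; split=> [[Q' [AQ' Q'P] gQ]|AQ]; last by exists Q.
suff <- : f @` Q' = f @` Q by [].
by apply/eqP; rewrite eqEfsubset !(partial_bij_imfsetS Pbij) ?gQ.
Qed.

Lemma partial_iso_extend P x : infty_ample Y ->
  (forall y, exists k, f k = x /\ g k = y) -> partial_iso P -> vertices X x ->
  exists P', [/\ partial_iso P', P `<=` P' & x \in f @` P'].
Proof.
move=> /infty_ampleP[_ ampY] fgx Piso Xx.
have [xP|xP] := boolP (x \in f @` P); first by exists P.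
have gPY : ([set` (g @` P)%fset] `<=` vertices Y)%classic.
  by move=> _ /imfsetP[k /= kP ->]; have [[/(_ k kP)[]]] := Piso.
have [y [Yy yP lky]] :=
  ampY _ _ gPY (transport_subcomplex Piso (@link_subcomplex _ X x)).
have [k [fk gk]] := fgx y.
exists (k |` P); split; last by rewrite imfsetU1 fk fset1U1.
  apply: partial_iso_fsetU1; rewrite ?fk ?gk// => Q QP.
  by rewrite lky ?imfsetS// transport_imfset.
exact: fsubsetU1.
Qed.

End PartialIsomorphisms.

Lemma partial_iso_sym (K T T' : choiceType) (f : K -> T) (g : K -> T')
    (X : simplicial_complex T) (Y : simplicial_complex T') (P : {fset K}) :
  partial_iso f g X Y P -> partial_iso g f Y X P.
Proof.
move=> [[PV Pinj] PXY]; split; [split=> [k /PV[]//|k l kP lP]|move=> Q /PXY];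
  by apply: iff_sym => //; exact: Pinj.
Qed.

Lemma infty_ample_isomorphic (T T' : choiceType)
    (X : simplicial_complex T) (Y : simplicial_complex T') :
  countable (vertices X) -> infty_ample X ->
  countable (vertices Y) -> infty_ample Y -> isomorphic X Y.
Proof.
move=> cX ampX cY ampY; pose I := partial_iso fst snd X Y.
have forth P x : I P -> vertices X x ->
    exists P', [/\ I P', P `<=` P' & x \in fst @` P'].
  by move=> IP Xx; apply: partial_iso_extend => // y; exists (x, y).
have back P y : I P -> vertices Y y ->
    exists P', [/\ I P', P `<=` P' & y \in snd @` P'].
  move=> /partial_iso_sym IP Yy.
  have pairs x : exists k : T * T', k.2 = y /\ k.1 = x by exists (x, y).
  have [P' [IP' PP' yP']] := partial_iso_extend ampX pairs IP Yy.
  by exists P'; split=> //; exact: partial_iso_sym.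
have Ibij P : I P -> partial_bij fst snd (vertices X) (vertices Y) P by case.
have [h hbij hP] :=
  back_and_forth cX cY (ampX 1 isT).1 Ibij (partial_iso0 _ _ X Y) forth back.
exists h; split=> // s /hP[P [IP sP hE]].
exact: partial_iso_simplexes IP sP hE.
Qed.

Theorem theorem9p1 :
  (exists (T : choiceType) (X : simplicial_complex T),
     countable (vertices X) /\ infty_ample X) /\
  (forall (T T' : choiceType)
     (X : simplicial_complex T) (Y : simplicial_complex T'),
     countable (vertices X) -> infty_ample X ->
     countable (vertices Y) -> infty_ample Y ->
     isomorphic X Y).
Proof.
split; last exact: infty_ample_isomorphic.
have [X ampX] := exists_infty_ample.
by exists nat, X; split=> //; exact: countableP.
Qed.
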